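(* Let $\phi:\mathbb R\to[0,\infty)$ be even, continuous, non-decreasing on $[0,\infty)$, with $\phi(x)/|x|\to\infty$ as $|x|\to\infty$, let $B\in\mathbb R$ with $\phi(0)<B$, and let $\Delta>0$. With $C$, $g_u^\lambda$, $g_l^\lambda$ and $r_M'(\Delta)$ as defined in the context, $$r_M'(\Delta)=\sup\bigl\{r\in\mathbb R:\ \exists\,\lambda=(\lambda_1,\lambda_2)\in C\ \text{such that}\ g_l^\lambda(x-\Delta)\,g_u^\lambda(y+\Delta)\ge e^{2r}\ \text{for all real }x\le y\bigr\}.$$
   Context: For $\lambda=(\lambda_1,\lambda_2)\in\mathbb R\times[0,\infty)$ put $g_u^\lambda(x)=1+\lambda_1x+\lambda_2(\phi(x)-B)$ and $g_l^\lambda(x)=1-\lambda_1x+\lambda_2(\phi(x)-B)$. Let $C$ be the set of $\lambda\in\mathbb R\times[0,\infty)$ with $g_u^\lambda(x)>0$ and $g_l^\lambda(x)>0$ for all $x\in\mathbb R$. For $\lambda\in C$ set $\psi_u^\lambda(x)=\log g_u^\lambda(x+\Delta)$ and $\psi_l^\lambda(x)=-\log g_l^\lambda(x-\Delta)$. The synthesis rate $r_M'(\Delta)$ is the supremum of all $r\in\mathbb R$ for which there exist $\lambda\in C$ and a non-decreasing $\psi:\mathbb R\to\mathbb R$ with $\psi_l^\lambda(x)+r\le\psi(x)\le\psi_u^\lambda(x)-r$ for all $x\in\mathbb R$. *)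

(* Defs.v *)
From mathcomp Require Import all_boot all_order all_algebra.
From mathcomp Require Import all_classical all_reals all_analysis.

Set Implicit Arguments.
Unset Strict Implicit.
Unset Printing Implicit Defensive.

Import Order.TTheory GRing.Theory Num.Theory.
Import numFieldNormedType.Exports.

Local Open Scope classical_set_scope.
Local Open Scope ring_scope.

Section SynthesisRate.
Context {R : realType}.
Implicit Types (phi : R -> R) (B Delta x : R) (lam : R * R).

Definition g_u phi B lam x : R := 1 + lam.1 * x + lam.2 * (phi x - B).

Definition g_l phi B lam x : R := 1 - lam.1 * x + lam.2 * (phi x - B).

Definition dual_set phi B : set (R * R) :=
  [set lam | 0 <= lam.2 /\
             forall x, 0 < g_u phi B lam x /\ 0 < g_l phi B lam x].

(* [ln] is total; these are used only for [lam] in [dual_set phi B], where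
   its argument is positive. *)
Definition psi_u phi B Delta lam x : R := ln (g_u phi B lam (x + Delta)).

Definition psi_l phi B Delta lam x : R := - ln (g_l phi B lam (x - Delta)).

(* The supremum is taken in [\bar R], so that no boundedness or nonemptiness
   is presupposed. *)
Definition synthesis_rate phi B Delta : \bar R :=
  ereal_sup [set r%:E | r in [set r : R |
    exists2 lam, dual_set phi B lam &
    exists2 psi : R -> R, {homo psi : x y / x <= y} &
    forall x, psi_l phi B Delta lam x + r <= psi x /\
              psi x <= psi_u phi B Delta lam x - r]].

End SynthesisRate.

(* Main.v *)
Require Import Defs.
From mathcomp Require Import all_boot all_order all_algebra.
From mathcomp Require Import all_classical all_reals all_analysis.
From mathcomp Require Import lra.

(* A non-decreasing function fits between [f] and [g] if and only if
   [f x <= g y] whenever [x <= y]. For [f = psi_l + r] and [g = psi_u - r],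
   exponentiating this condition gives the product inequality, so the two
   suprema range over the same set. *)

Set Implicit Arguments.
Unset Strict Implicit.
Unset Printing Implicit Defensive.

Import Order.TTheory GRing.Theory Num.Theory.
Import numFieldNormedType.Exports.

Local Open Scope classical_set_scope.
Local Open Scope ring_scope.

Lemma homo_between (R : realType) (f g : R -> R) :
  (exists2 psi : R -> R, {homo psi : x y / x <= y} &
     forall x, f x <= psi x /\ psi x <= g x) <->
  (forall x y, x <= y -> f x <= g y).
Proof.
split=> [[psi psi_nd fg] x y xy|fg].
  by apply: le_trans (fg x).1 _; apply: le_trans (psi_nd _ _ xy) (fg y).2.
(* The least candidate: the running supremum of [f]. *)
pose below x := [set f t | t in [set t | t <= x]].
(* [sup] takes a default value on empty or unbounded sets; the bound [g x] and the element [f x]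
   exclude both cases for [below x]. *)
have below_ub x : ubound (below x) (g x) by move=> _ [t /= tx <-]; exact: fg.
have f_below t x : t <= x -> f t <= sup (below x).
  by move=> tx; apply: ub_le_sup; [exists (g x) | exists t].
have below_neq0 x : below x !=set0 by exists (f x), x => /=.
exists (fun x => sup (below x)) => [x y xy|x].
  apply: ge_sup => // _ [t /= tx <-].
  by apply: f_below; exact: le_trans xy.
by split; [exact: f_below | exact: ge_sup].
Qed.

(** Membership in [dual_set] makes both factors positive, so [ln] turns their product into a sum.
    The two shifts by [r] combine into [2 * r]. *)
Lemma psi_l_le_psi_u (R : realType) (phi : R -> R) (B Delta r x y : R)
    (lam : R * R) :
  dual_set phi B lam ->
  (psi_l phi B Delta lam x + r <= psi_u phi B Delta lam y - r) =
  (expR (2 * r) <= g_l phi B lam (x - Delta) * g_u phi B lam (y + Delta)).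
Proof.
move=> [_ g_gt0]; rewrite /psi_l /psi_u.
have [_ gl_gt0] := g_gt0 (x - Delta); have [gu_gt0 _] := g_gt0 (y + Delta).
rewrite -[in RHS](lnK (mulr_gt0 gl_gt0 gu_gt0)) ler_expR lnM //.
by apply/idP/idP; lra.
Qed.

Theorem lemma2 (R : realType) (phi : R -> R) (B Delta : R)
  (phi_ge0 : forall x : R, 0 <= phi x)
  (phi_even : forall x : R, phi (- x) = phi x)
  (phi_cont : continuous phi)
  (phi_nd : {in `[0, +oo[ &, {homo phi : x y / x <= y}})
  (phi_pinfty : phi x / `|x| @[x --> +oo] --> +oo)
  (phi_ninfty : phi x / `|x| @[x --> -oo] --> +oo)
  (phi0_ltB : phi 0 < B)
  (Delta_gt0 : 0 < Delta) :
  synthesis_rate phi B Delta =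
  ereal_sup [set r%:E | r in [set r : R |
    exists2 lam : R * R, dual_set phi B lam &
    forall x y : R, x <= y ->
      expR (2 * r) <= g_l phi B lam (x - Delta) * g_u phi B lam (y + Delta)]].
Proof.
rewrite /synthesis_rate; congr (ereal_sup (_ @` _)).
(* For each [r] the same [lam] serves in both directions; only [psi] is exchanged for the condition
   on pairs [x <= y]. *)
apply/seteqP; split=> r /= [lam lamC].
  case=> psi psi_nd psi_bnd; exists lam => // x y xy.
  rewrite -psi_l_le_psi_u //.
  by move: x y xy; apply/homo_between; exists psi.
move=> le_gg; exists lam => //.
by apply/homo_between => x y xy; rewrite psi_l_le_psi_u // le_gg.
Qed.
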